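(* Let $M$ be a multiplication $R$-module and let $X$ be a proper submodule of $M$. Suppose that $\psi:S(R)\to S(R)\cup\{\emptyset\}$ is a function with $(\phi(X):_{R}M)=\psi((X:_{R}M))$. Then the following are equivalent: (1) $X$ is $\phi$-prime in $M$. (2) $(X:_{R}M)$ is a $\psi$-prime ideal of $R$.
   Context: $R$ is an associative ring with identity, not necessarily commutative, and $M$ is a unitary right $R$-module. $S(M)$ is the set of all submodules of $M$ and $S(R)$ the set of all (two-sided) ideals of $R$; ''ideal'' means two-sided ideal. For a submodule $Y$ of $M$ and $I\subseteq R$, $YI$ is the set of finite sums of elements $yr$ with $y\in Y$, $r\in I$. For $N\in S(M)\cup\{\emptyset\}$, $(N:_{R}M)=\{r\in R: Mr\subseteq N\}$. $M$ is a multiplication module if for every $X\in S(M)$ there is an ideal $I$ of $R$ with $X=MI$. A function $\phi:S(M)\to S(M)\cup\{\emptyset\}$ is fixed, with the standing convention that $\phi(X)\subseteq X$ for every $X\in S(M)$. A proper submodule $X$ of $M$ is $\phi$-prime if for every $Y\in S(M)$ and every ideal $I$ of $R$, $YI\subseteq X$ and $YI\nsubseteq\phi(X)$ imply $Y\subseteq X$ or $I\subseteq(X:_{R}M)$. For $\psi:S(R)\to S(R)\cup\{\emptyset\}$, a proper ideal $A$ of $R$ is $\psi$-prime if for all $I,J\in S(R)$, $IJ\subseteq A$ and $IJ\nsubseteq\psi(A)$ imply $I\subseteq A$ or $J\subseteq A$. *)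

(* Defs.v *)
From HB Require Import structures.
From mathcomp Require Import all_boot all_algebra.
From mathcomp Require Import mathcomp_extra boolp classical_sets.

Set Implicit Arguments.
Unset Strict Implicit.
Unset Printing Implicit Defensive.

Import GRing.Theory.
Local Open Scope classical_set_scope.
Local Open Scope ring_scope.

(* A unitary right R-module is a left module over the converse ring R^c, in   *)
(* which (a : R^c) * b is b * a computed in R: the axiom                      *)
(* a *: (b *: v) = (a * b) *: v over R^c then reads (v b) a = v (b a).        *)
(* pzRingType does not require commutativity and allows the zero ring.        *)
Notation rmodType R := (lmodType R^c).

(* y r, the right action of R on M *)
Definition ract (R : pzRingType) (M : rmodType R) (y : M) (r : R) : M :=
  (r : R^c) *: y.

Record submodule (R : pzRingType) (M : rmodType R) := Submodule {
  submodule_set :> set M;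
  submoduleP : submod_closed [in submodule_set]
}.

Record ideal (R : pzRingType) := Ideal {
  ideal_set :> set R;
  idealP : zmod_closed [in ideal_set];
  ideal_mull : forall r a : R, ideal_set a -> ideal_set (r * a);
  ideal_mulr : forall a r : R, ideal_set a -> ideal_set (a * r)
}.

(* S(M) \cup {\emptyset} and S(R) \cup {\emptyset}; a submodule or an ideal    *)
(* contains 0, so the empty set is a genuinely new value.                     *)
Record submodule0 (R : pzRingType) (M : rmodType R) := Submodule0 {
  submodule0_set :> set M;
  submodule0P : submodule0_set = set0 \/
                exists Y : submodule M, submodule0_set = Y
}.

Record ideal0 (R : pzRingType) := Ideal0 {
  ideal0_set :> set R;
  ideal0P : ideal0_set = set0 \/ exists I : ideal R, ideal0_set = I
}.

(* Y I: the finite sums of elements y r with y in Y and r in I *)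
Definition mod_mul (R : pzRingType) (M : rmodType R) (Y : set M) (I : set R) :
    set M :=
  [set x | exists (n : nat) (y : 'I_n -> M) (r : 'I_n -> R),
    [/\ forall i, Y (y i), forall i, I (r i) & x = \sum_(i < n) ract (y i) (r i)]].

(* I J: the finite sums of products a b with a in I and b in J *)
Definition ideal_mul (R : pzRingType) (I J : set R) : set R :=
  [set x | exists (n : nat) (a b : 'I_n -> R),
    [/\ forall i, I (a i), forall i, J (b i) & x = \sum_(i < n) a i * b i]].

(* (N :_R M) *)
Definition colon (R : pzRingType) (M : rmodType R) (N : set M) : set R :=
  [set r | forall m : M, N (ract m r)].

Lemma colon_zmod_closed (R : pzRingType) (M : rmodType R) (X : submodule M) :
  zmod_closed [in colon X].
Proof.
have [X0 XB] : zmod_closed [in (X : set M)] := GRing.submod_closedB (submoduleP X).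
split=> [|a b].
  by apply/mem_set => m; rewrite /ract scale0r; apply/set_mem.
move=> /set_mem aX /set_mem bX; apply/mem_set => m.
have -> : ract m (a - b) = ract m a - ract m b.
  exact: (scalerBl (a : R^c) b m).
by apply/set_mem; apply: XB; apply/mem_set.
Qed.

Lemma colon_mull (R : pzRingType) (M : rmodType R) (X : submodule M) (r a : R) :
  colon X a -> colon X (r * a).
Proof.
move=> aX m; have -> : ract m (r * a) = ract (ract m r) a.
  by rewrite /ract scalerA.
exact: aX.
Qed.

Lemma colon_mulr (R : pzRingType) (M : rmodType R) (X : submodule M) (a r : R) :
  colon X a -> colon X (a * r).
Proof.
have [X0 XL] := submoduleP X.
move=> aX m; have -> : ract m (a * r) = (r : R^c) *: ract m a + 0.
  by rewrite /ract scalerA addr0.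
by apply/set_mem; apply: XL => //; apply/mem_set.
Qed.

(* (X :_R M) as an element of S(R), for X in S(M) *)
Definition colon_ideal (R : pzRingType) (M : rmodType R) (X : submodule M) :
    ideal R :=
  Ideal (colon_zmod_closed X) (@colon_mull R M X) (@colon_mulr R M X).

Definition multiplication_module (R : pzRingType) (M : rmodType R) : Prop :=
  forall X : submodule M, exists I : ideal R,
    (X : set M) = mod_mul [set: M] I.

Definition phi_prime (R : pzRingType) (M : rmodType R)
    (phi : submodule M -> submodule0 M) (X : submodule M) : Prop :=
  (X : set M) <> [set: M] /\
  forall (Y : submodule M) (I : ideal R),
    mod_mul Y I `<=` X -> ~ (mod_mul Y I `<=` phi X) ->
    Y `<=` X \/ I `<=` colon X.

Definition psi_prime (R : pzRingType) (psi : ideal R -> ideal0 R) (A : ideal R) :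
    Prop :=
  (A : set R) <> [set: R] /\
  forall I J : ideal R,
    ideal_mul I J `<=` A -> ~ (ideal_mul I J `<=` psi A) ->
    I `<=` A \/ J `<=` A.

(* Main.v *)
Require Import Defs.
From mathcomp Require Import all_boot all_algebra.
From mathcomp Require Import boolp classical_sets.

Local Open Scope classical_set_scope.

(** Multiplying [M] by ideals is adjoint to the colon: for a submodule [N],
    [M I] lies in [N] exactly when [I] lies in [(N : M)] ([mod_mul_sub_colon]).
    Since [m (a b) = (m a) b], likewise [(M I) J] lies in [N] exactly when [I J]
    lies in [(N : M)] ([mod_mul_mul_sub_colon]).  This also holds for
    [N = phi X] when that value is empty, because [I J] always contains [0]
    while the colon of the empty set by [M] is empty.

    Taking [N = X] and [N = phi X], with [(phi X : M) = psi (X : M)], one sees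
    that the [phi]-prime condition for the submodule [M I] and the ideal [J] is
    the [psi]-prime condition for the ideals [I] and [J].  In a multiplication
    module every submodule is of the form [M I], so these are all the instances
    of the [phi]-prime condition. *)

Import GRing.Theory.
Local Open Scope ring_scope.

Section ColonAdjunction.

Set Implicit Arguments.
Unset Strict Implicit.

Variables (R : pzRingType) (M : rmodType R).
Implicit Types (m : M) (I J : set R) (N : submodule M).

Lemma ractA m (a b : R) : ract m (a * b) = ract (ract m a) b.
Proof. by rewrite /ract scalerA. Qed.

Lemma ract_suml n (y : 'I_n -> M) (r : R) :
  ract (\sum_(i < n) y i) r = \sum_(i < n) ract (y i) r.
Proof. exact: scaler_sumr. Qed.

Lemma ract_sumr n m (r : 'I_n -> R) :
  ract m (\sum_(i < n) r i) = \sum_(i < n) ract m (r i).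
Proof. exact: (@scaler_suml R^c M). Qed.

Lemma submodule_sum N n (y : 'I_n -> M) :
  (forall i, (N : set M) (y i)) -> (N : set M) (\sum_(i < n) y i).
Proof.
move=> Ny; have [N0 NL] := submoduleP N.
apply: (big_ind (N : set M)) => [|u v Nu Nv|i _]; last exact: Ny.
  exact/set_mem.
by rewrite -[u]scale1r; apply/set_mem/NL; apply/mem_set.
Qed.

Lemma mod_mul_ract (Y : set M) I m (r : R) :
  Y m -> I r -> mod_mul Y I (ract m r).
Proof.
by move=> Ym Ir; exists 1%N, (fun=> m), (fun=> r); rewrite big_ord1.
Qed.

Lemma ideal_mul_mul I J (a b : R) : I a -> J b -> ideal_mul I J (a * b).
Proof.
by move=> Ia Jb; exists 1%N, (fun=> a), (fun=> b); rewrite big_ord1.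
Qed.

Lemma mod_mul_sub (Y : set M) I N :
  (forall m r, Y m -> I r -> (N : set M) (ract m r)) -> mod_mul Y I `<=` N.
Proof.
move=> YIN _ [n [y [r [Yy Ir ->]]]].
by apply: submodule_sum => i; apply: YIN.
Qed.

Lemma mod_mul_sub_colon I N : mod_mul [set: M] I `<=` N <-> I `<=` colon N.
Proof.
split=> [MIN r Ir m|IN]; first exact/MIN/mod_mul_ract.
by apply: mod_mul_sub => m r _ /IN.
Qed.

(** Associativity [m (a b) = (m a) b] on generators, extended to sums because a
    nonempty [N] is a submodule.  For empty [N] both sides fail, since both
    products contain the empty sum. *)
Lemma mod_mul_mul_sub_colon I J (N : submodule0 M) :
  mod_mul (mod_mul [set: M] I) J `<=` N <-> ideal_mul I J `<=` colon N.
Proof.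
split=> [MIJN _ [n [a [b [Ia Jb ->]]]] m|IJN].
  apply: MIJN; exists n, (fun i => ract m (a i)), b.
  split=> // [i|]; first exact: mod_mul_ract.
  by rewrite ract_sumr; apply: eq_bigr => i _; rewrite ractA.
have [N0|[N' NE]] := submodule0P N.
  have IJ0 : ideal_mul I J 0.
    by exists 0%N, (fun=> 0), (fun=> 0); split=> [[]|[]|] //; rewrite big_ord0.
  by have := IJN _ IJ0 0; rewrite N0.
rewrite NE in IJN *; apply: mod_mul_sub => _ b [n [m [a [_ Ia ->]]]] Jb.
rewrite ract_suml; apply: submodule_sum => i.
by rewrite -ractA; apply: IJN; apply: ideal_mul_mul.
Qed.

(** [M I] is stable under the action of [R] because [I] absorbs the scalar:
    [(m a) r = m (a r)]; sums are concatenated. *)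
Lemma mod_mul_submod_closed (I : ideal R) :
  submod_closed [in mod_mul [set: M] I].
Proof.
split.
  apply/mem_set; exists 0%N, (fun=> 0), (fun=> 0).
  by split=> [[]|[]|] //; rewrite big_ord0.
move=> r _ _ /set_mem[n [y [a [_ Ia ->]]]] /set_mem[p [z [b [_ Ib ->]]]].
apply/mem_set; exists (n + p)%N.
exists (fun i => match split i with inl j => y j | inr j => z j end).
exists (fun i => match split i with inl j => a j * r | inr j => b j end).
split=> // [i|]; first by case: split => j //; apply: ideal_mulr.
rewrite big_split_ord /= scaler_sumr; congr (_ + _); apply: eq_bigr => i _.
  by rewrite (unsplitK (inl i)) ractA.
by rewrite (unsplitK (inr i)).
Qed.

Definition mod_mul_submodule (I : ideal R) : submodule M :=
  Submodule (mod_mul_submod_closed I).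

Definition submodule0_of (N : submodule M) : submodule0 M :=
  Submodule0 (or_intror (ex_intro _ N erefl)).

Lemma colon_proper N :
  (N : set M) <> [set: M] -> (colon_ideal N : set R) <> [set: R].
Proof.
move=> properN colonT; apply: properN; apply/seteqP; split=> // m _.
have : colon N (1 : R) by rewrite -[colon N]/(colon_ideal N : set R) colonT.
by move=> /(_ m); rewrite /ract scale1r.
Qed.

End ColonAdjunction.

Theorem theorem9 (R : pzRingType) (M : rmodType R)
    (phi : submodule M -> submodule0 M)
    (phi_sub : forall Y : submodule M, phi Y `<=` Y)
    (mulM : multiplication_module M)
    (X : submodule M) (properX : (X : set M) <> [set: M])
    (psi : ideal R -> ideal0 R)
    (psiX : colon (phi X) = psi (colon_ideal X)) :
  phi_prime phi X <-> psi_prime psi (colon_ideal X).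
Proof.
have subX (I J : set R) := mod_mul_mul_sub_colon I J (submodule0_of X).
split=> [[_ primeX]|[_ primeA]]; split=> //.
- exact: colon_proper.
- move=> I J IJX; rewrite -psiX => IJphi.
  have [||MIX|JX] := primeX (mod_mul_submodule M I) J; last by right.
  + exact/subX.
  + by move=> /mod_mul_mul_sub_colon.
  + by left; apply/mod_mul_sub_colon.
- move=> Y J; have [I ->] := mulM Y => IJX IJphi.
  have [||IX|JX] := primeA I J; last by right.
  + exact/subX.
  + by rewrite -psiX => /mod_mul_mul_sub_colon.
  + by left; apply/mod_mul_sub_colon.
Qed.
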